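(* Let $\mathcal C$ be a category with finite products and $\blacktriangleright:\mathcal C\to\mathcal C$ an endofunctor with a natural transformation $p:\mathrm{Id}\to\blacktriangleright$. 1. Whenever $(\mathcal C,\blacktriangleright,\mathsf{Tr})$ is a guarded traced category, $(\mathcal C,\blacktriangleright,\dagger_{\mathsf{Tr}})$ is a guarded Conway category, where for $f:\blacktriangleright X\times A\to X$ one puts $f^{\dagger_{\mathsf{Tr}}}=\mathsf{Tr}^X_{A,X}(\langle f,f\rangle):A\to X$. Furthermore, $\mathsf{Tr}_{\dagger_{\mathsf{Tr}}}$ is the original operator $\mathsf{Tr}$. 2. Whenever $(\mathcal C,\blacktriangleright,\dagger)$ is a guarded Conway category, $(\mathcal C,\blacktriangleright,\mathsf{Tr}_\dagger)$ is a guarded traced category, where for $f:\blacktriangleright X\times A\to X\times B$ one puts $(\mathsf{Tr}_\dagger)^X_{A,B}(f)=\pi_r\cdot f\cdot(p_X\times A)\cdot\langle(\pi_\ell\cdot f)^\dagger,A\rangle:A\to B$. Furthermore, $\dagger_{\mathsf{Tr}_\dagger}$ is the original operator $\dagger$.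
   Context: Notation: objects also denote their identity morphisms; $g\cdot f$ is composition ($f$ first); $\pi_\ell,\pi_r$ are the left and right product projections; $\Delta:A\to A\times A$ is the diagonal; $\mathsf{can}=\langle\blacktriangleright\pi_\ell,\blacktriangleright\pi_r\rangle:\blacktriangleright(X\times Y)\to\blacktriangleright X\times\blacktriangleright Y$; $1$ is the terminal object, and $1\times X$ is identified with $X$. A guarded Conway category $(\mathcal C,\blacktriangleright,\dagger)$ has a family of operations $\dagger_{X,Y}:\mathcal C(\blacktriangleright X\times Y,X)\to\mathcal C(Y,X)$, $f\mapsto f^\dagger$, satisfying: ($\dagger$) $f^\dagger=f\cdot(p_X\times Y)\cdot\langle f^\dagger,Y\rangle$ for $f:\blacktriangleright X\times Y\to X$; (P) $f^\dagger\cdot h=(f\cdot(\blacktriangleright X\times h))^\dagger$ for $f:\blacktriangleright X\times Y\to X$, $h:Z\to Y$; (C) $(g\cdot f)^\dagger=g\cdot(f\cdot(\blacktriangleright g\times Y))^\dagger$ for $f:\blacktriangleright X\times Y\to Z$, $g:Z\to X$; ($\dagger\dagger$) $f^{\dagger\dagger}=(f\cdot(\Delta\times Y))^\dagger$ for $f:\blacktriangleright X\times\blacktriangleright X\times Y\to X$ (with $f^\dagger:\blacktriangleright X\times Y\to X$ taken in the first component). A guarded traced category $(\mathcal C,\blacktriangleright,\mathsf{Tr})$ has a (cartesian) guarded trace operator, i.e. a family $\mathsf{Tr}^X_{A,B}:\mathcal C(\blacktriangleright X\times A,X\times B)\to\mathcal C(A,B)$ satisfying: (V1) $\mathsf{Tr}^1_{A,B}(f)=f\cdot(p_1\times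 A)$ for $f:\blacktriangleright 1\times A\to B\cong 1\times B$ (using $A\cong1\times A$); (V2) $\mathsf{Tr}^Y_{A,B}(\mathsf{Tr}^X_{\blacktriangleright Y\times A,Y\times B}(f))=\mathsf{Tr}^{X\times Y}_{A,B}(f\cdot(\mathsf{can}\times A))$ for $f:\blacktriangleright X\times\blacktriangleright Y\times A\to X\times Y\times B$; (S) $\mathsf{Tr}^X_{A\times C,B\times C}(f\times C)=\mathsf{Tr}^X_{A,B}(f)\times C$ for $f:\blacktriangleright X\times A\to X\times B$; (Y) $\mathsf{Tr}^X_{X,\blacktriangleright X}(c)=p_X$ for the canonical swap isomorphism $c:\blacktriangleright X\times X\to X\times\blacktriangleright X$; and naturality, which is expressed by: (Lt) $\mathsf{Tr}^X_{A',B}(f\cdot(\blacktriangleright X\times g))=\mathsf{Tr}^X_{A,B}(f)\cdot g$ for $f:\blacktriangleright X\times A\to X\times B$, $g:A'\to A$; (Rt) $\mathsf{Tr}^X_{A,B'}((X\times g)\cdot f)=g\cdot\mathsf{Tr}^X_{A,B}(f)$ for $f:\blacktriangleright X\times A\to X\times B$, $g:B\to B'$; (Sl) $\mathsf{Tr}^X_{A,B}((g\times B)\cdot f)=\mathsf{Tr}^{X'}_{A,B}(f\cdot(\blacktriangleright g\times A))$ for $f:\blacktriangleright X\times A\to X'\times B$, $g:X'\to X$. *)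

(* Defs.v *)
Set Implicit Arguments.
Unset Strict Implicit.
Unset Printing Implicit Defensive.

Declare Scope cat_scope.
Delimit Scope cat_scope with cat.
Local Open Scope cat_scope.

Reserved Notation "g ∘ f" (at level 40, left associativity).
Reserved Notation "A × B" (at level 35, right associativity).
Reserved Notation "f ⊗ g" (at level 35, right associativity).
Reserved Notation "⟨ f , g ⟩" (at level 0, f at level 200, g at level 200).

Record category := Category {
  obj :> Type;
  hom : obj -> obj -> Type;
  idm : forall A, hom A A;
  comp : forall A B C, hom B C -> hom A B -> hom A C;
  comp_idl : forall A B (f : hom A B), comp (idm B) f = f;
  comp_idr : forall A B (f : hom A B), comp f (idm A) = f;
  comp_assoc : forall A B C D (h : hom C D) (g : hom B C) (f : hom A B),
    comp h (comp g f) = comp (comp h g) f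
}.

Arguments hom {c} A B.
Arguments idm {c} A.

Notation "g ∘ f" := (comp g f) : cat_scope.

(* Finite products are given as a chosen terminal object and chosen binary
   products. *)
Record cartesian_category := CartesianCategory {
  cart_cat :> category;
  one : cart_cat;
  bang : forall A : cart_cat, hom A one;
  bang_unique : forall (A : cart_cat) (f : hom A one), f = bang A;
  prd : cart_cat -> cart_cat -> cart_cat;
  prl : forall A B : cart_cat, hom (prd A B) A;
  prr : forall A B : cart_cat, hom (prd A B) B;
  pair : forall Z A B : cart_cat, hom Z A -> hom Z B -> hom Z (prd A B);
  prl_pair : forall (Z A B : cart_cat) (f : hom Z A) (g : hom Z B),
    prl A B ∘ pair f g = f;
  prr_pair : forall (Z A B : cart_cat) (f : hom Z A) (g : hom Z B),
    prr A B ∘ pair f g = g;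
  pair_unique : forall (Z A B : cart_cat) (h : hom Z (prd A B)),
    h = pair (prl A B ∘ h) (prr A B ∘ h)
}.

Arguments one {c}.
Arguments bang {c} A.
Arguments prl {c} A B.
Arguments prr {c} A B.

Notation "A × B" := (prd A B) : cat_scope.
Notation "⟨ f , g ⟩" := (pair f g) : cat_scope.

Record functor (C D : category) := Functor {
  fobj :> C -> D;
  fmap : forall A B : C, hom A B -> hom (fobj A) (fobj B);
  fmap_id : forall A : C, fmap (idm A) = idm (fobj A);
  fmap_comp : forall (A B E : C) (g : hom B E) (f : hom A B),
    fmap (g ∘ f) = fmap g ∘ fmap f
}.

Arguments fmap {C D} f {A B} _ : rename.

Definition id_functor (C : category) : functor C C :=
  @Functor C C (fun A => A) (fun _ _ f => f)
    (fun _ => eq_refl) (fun _ _ _ _ _ => eq_refl).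

Record nat_trans (C D : category) (F G : functor C D) := NatTrans {
  nt_app :> forall A : C, hom (F A) (G A);
  nt_natural : forall (A B : C) (f : hom A B),
    nt_app B ∘ fmap F f = fmap G f ∘ nt_app A
}.

Section Products.
Context {C : cartesian_category}.

Definition prod_map (A A' B B' : C) (f : hom A A') (g : hom B B') :
  hom (A × B) (A' × B') := ⟨f ∘ prl A B, g ∘ prr A B⟩.

Definition diag (A : C) : hom A (A × A) := ⟨idm A, idm A⟩.

Definition swap (A B : C) : hom (A × B) (B × A) := ⟨prr A B, prl A B⟩.

Definition assoc (X Y Z : C) : hom ((X × Y) × Z) (X × (Y × Z)) :=
  ⟨prl X Y ∘ prl (X × Y) Z, ⟨prr X Y ∘ prl (X × Y) Z, prr (X × Y) Z⟩⟩.

Definition assoc_inv (X Y Z : C) : hom (X × (Y × Z)) ((X × Y) × Z) :=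
  ⟨⟨prl X (Y × Z), prl Y Z ∘ prr X (Y × Z)⟩, prr Y Z ∘ prr X (Y × Z)⟩.

Definition lunit_inv (A : C) : hom A (one × A) := ⟨bang A, idm A⟩.

Definition can (L : functor C C) (X Y : C) : hom (L (X × Y)) (L X × L Y) :=
  ⟨fmap L (prl X Y), fmap L (prr X Y)⟩.

End Products.

Notation "f ⊗ g" := (prod_map f g) : cat_scope.

(* Unparenthesised triple products on paper are read as right-nested products
   [A × (B × C)], the other bracketing being related to this one by [assoc]. *)

Definition dagger_op (C : cartesian_category) (L : functor C C) :=
  forall X Y : C, hom (L X × Y) X -> hom Y X.

Definition trace_op (C : cartesian_category) (L : functor C C) :=
  forall X A B : C, hom (L X × A) (X × B) -> hom A B.

Section Guarded.
Variables (C : cartesian_category) (L : functor C C).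
Variable p : nat_trans (id_functor C) L.

Record guarded_conway (dag : dagger_op L) : Prop := GuardedConway {
  dag_fixpoint : forall (X Y : C) (f : hom (L X × Y) X),
    dag X Y f = f ∘ (p X ⊗ idm Y) ∘ ⟨dag X Y f, idm Y⟩;
  dag_parameter : forall (X Y Z : C) (f : hom (L X × Y) X) (h : hom Z Y),
    dag X Y f ∘ h = dag X Z (f ∘ (idm (L X) ⊗ h));
  dag_composition : forall (X Y Z : C) (f : hom (L X × Y) Z) (g : hom Z X),
    dag X Y (g ∘ f) = g ∘ dag Z Y (f ∘ (fmap L g ⊗ idm Y));
  dag_double : forall (X Y : C) (f : hom (L X × (L X × Y)) X),
    dag X Y (dag X (L X × Y) f) =
    dag X Y (f ∘ assoc (L X) (L X) Y ∘ (diag (L X) ⊗ idm Y))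
}.

Record guarded_traced (Tr : trace_op L) : Prop := GuardedTraced {
  tr_vanishing1 : forall (A B : C) (f : hom (L one × A) B),
    Tr one A B (lunit_inv B ∘ f) = f ∘ (p one ⊗ idm A) ∘ lunit_inv A;
  tr_vanishing2 : forall (X Y A B : C)
      (f : hom (L X × (L Y × A)) (X × (Y × B))),
    Tr Y A B (Tr X (L Y × A) (Y × B) f) =
    Tr (X × Y) A B
      (assoc_inv X Y B ∘ f ∘ assoc (L X) (L Y) A ∘ (can L X Y ⊗ idm A));
  tr_superposing : forall (X A B D : C) (f : hom (L X × A) (X × B)),
    Tr X (A × D) (B × D)
      (assoc X B D ∘ (f ⊗ idm D) ∘ assoc_inv (L X) A D) =
    Tr X A B f ⊗ idm D;
  tr_yanking : forall X : C, Tr X X (L X) (swap (L X) X) = p X;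
  tr_left_tightening : forall (X A A' B : C)
      (f : hom (L X × A) (X × B)) (g : hom A' A),
    Tr X A' B (f ∘ (idm (L X) ⊗ g)) = Tr X A B f ∘ g;
  tr_right_tightening : forall (X A B B' : C)
      (f : hom (L X × A) (X × B)) (g : hom B B'),
    Tr X A B' ((idm X ⊗ g) ∘ f) = g ∘ Tr X A B f;
  tr_sliding : forall (X X' A B : C)
      (f : hom (L X × A) (X' × B)) (g : hom X' X),
    Tr X A B ((g ⊗ idm B) ∘ f) = Tr X' A B (f ∘ (fmap L g ⊗ idm A))
}.

Definition dagger_of_trace (Tr : trace_op L) : dagger_op L :=
  fun X A f => Tr X A X ⟨f, f⟩.

Definition trace_of_dagger (dag : dagger_op L) : trace_op L :=
  fun X A B f =>
    prr X B ∘ f ∘ (p X ⊗ idm A) ∘ ⟨dag X A (prl X B ∘ f), idm A⟩.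

End Guarded.

(* Main.v *)
(* Both directions rest on one formula.  For a guarded trace and
   [f1 : L X × A → X], discarding the feedback wire gives [Tr ⟨f1, prr⟩ = id],
   while yanking, vanishing and sliding along the diagonal give
   [Tr ⟨f1, prl⟩ = p ∘ Tr ⟨f1, f1⟩]; hence
   [Tr ⟨f1, f2⟩ = f2 ∘ ⟨p ∘ Tr ⟨f1, f1⟩, id⟩], which recovers [Tr] from its
   dagger.  Conversely, the only non-formal trace axiom for a dagger is
   vanishing for [X × Y], which is the guarded Bekić identity; it follows from
   the double dagger axiom and from the composition axiom applied to the two
   projections. *)
From Stdlib Require Import Setoid.
Require Import Defs.
Set Implicit Arguments.
Unset Strict Implicit.
Local Open Scope cat_scope.

(** * Calculus of pairings and naturality of [p] *)

Section Cartesian.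
Context {C : cartesian_category}.

Lemma pair_comp (W Z A B : C) (f : hom Z A) (g : hom Z B) (h : hom W Z) :
  ⟨f, g⟩ ∘ h = ⟨f ∘ h, g ∘ h⟩.
Proof.
  rewrite (pair_unique (⟨f, g⟩ ∘ h)), !comp_assoc, prl_pair, prr_pair.
  reflexivity.
Qed.

Lemma pair_eta (Z A B : C) (h : hom Z (A × B)) :
  ⟨prl A B ∘ h, prr A B ∘ h⟩ = h.
Proof. symmetry; apply pair_unique. Qed.

Lemma pair_prl_prr (A B : C) : ⟨prl A B, prr A B⟩ = idm (A × B).
Proof.
  rewrite <- (pair_eta (idm (A × B))), !comp_idr; reflexivity.
Qed.

Lemma bang_eq (A : C) (f g : hom A one) : f = g.
Proof. rewrite (bang_unique f), (bang_unique g); reflexivity. Qed.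

Lemma fmap_fuse (D E : category) (L : functor D E) (U : E) (A B B' : D)
    (g : hom B B') (f : hom A B) (h : hom U (L A)) :
  fmap L g ∘ (fmap L f ∘ h) = fmap L (g ∘ f) ∘ h.
Proof. rewrite fmap_comp, comp_assoc; reflexivity. Qed.

Lemma point_natural (L : functor C C) (p : nat_trans (id_functor C) L)
    (A B : C) (f : hom A B) :
  (p B : hom B (L B)) ∘ f = fmap L f ∘ (p A : hom A (L A)).
Proof. exact (nt_natural p f). Qed.

Lemma point_natural_comp (L : functor C C) (p : nat_trans (id_functor C) L)
    (U A B : C) (f : hom A B) (h : hom U A) :
  (p B : hom B (L B)) ∘ (f ∘ h) = fmap L f ∘ ((p A : hom A (L A)) ∘ h).
Proof. rewrite !comp_assoc, point_natural; reflexivity. Qed.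

End Cartesian.

(* Right-nested composites with pairings pushed outermost and consecutive
   [fmap]s fused, so that projections meet the pairings they act on. *)
Ltac cart_norm :=
  cbn [fobj id_functor];
  unfold prod_map, diag, swap, assoc, assoc_inv, lunit_inv, can;
  repeat first
    [ rewrite <- comp_assoc | rewrite comp_idl | rewrite comp_idr
    | rewrite pair_comp | rewrite prl_pair | rewrite prr_pair
    | rewrite fmap_fuse | rewrite <- fmap_comp | rewrite fmap_id
    | rewrite pair_eta | rewrite pair_prl_prr ].

Ltac cart := cart_norm; reflexivity.

(** * From guarded traces to guarded daggers *)

Section TraceToDagger.
Context {C : cartesian_category} {L : functor C C}.
Context {p : nat_trans (id_functor C) L}.
(* The cast gives [p X] the syntactic domain [X] instead of [id_functor C X],
   without which rewriting fails to match. *)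
Local Notation pt X := (p X : hom X (L X)).
Context {Tr : trace_op L}.
Arguments Tr : clear implicits.
Hypothesis HTr : guarded_traced p Tr.

Lemma trace_post (X A B B' : C) (f : hom (L X × A) X)
    (h : hom (L X × A) B) (g : hom B B') :
  Tr X A B' ⟨f, g ∘ h⟩ = g ∘ Tr X A B ⟨f, h⟩.
Proof.
  rewrite <- (tr_right_tightening HTr); f_equal; cart.
Qed.

Lemma trace_pre (X A A' B : C) (f : hom (L X × A) X)
    (h : hom (L X × A) B) (g : hom A' A) :
  Tr X A' B ⟨f ∘ (idm (L X) ⊗ g), h ∘ (idm (L X) ⊗ g)⟩ =
  Tr X A B ⟨f, h⟩ ∘ g.
Proof.
  rewrite <- (tr_left_tightening HTr), pair_comp; reflexivity.
Qed.

Lemma trace_pair (X A B D : C) (f : hom (L X × A) X)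
    (h : hom (L X × A) B) (k : hom (L X × A) D) :
  Tr X A (B × D) ⟨f, ⟨h, k⟩⟩ = ⟨Tr X A B ⟨f, h⟩, Tr X A D ⟨f, k⟩⟩.
Proof.
  rewrite (pair_unique (Tr X A (B × D) ⟨f, ⟨h, k⟩⟩)), <- !trace_post.
  rewrite prl_pair, prr_pair; reflexivity.
Qed.

(* Superposing the trace of [⟨f, bang⟩], which is necessarily [bang], with the
   identity. *)
Lemma trace_prr (X A : C) (f : hom (L X × A) X) :
  Tr X A A ⟨f, prr (L X) A⟩ = idm A.
Proof.
  assert (E : ⟨f, prr (L X) A⟩ =
    (idm X ⊗ prr one A) ∘
    (assoc X one A ∘ (⟨f, bang (L X × A)⟩ ⊗ idm A) ∘ assoc_inv (L X) A A
      ∘ (idm (L X) ⊗ diag A))) by cart.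
  rewrite E, (tr_right_tightening HTr), (tr_left_tightening HTr),
    (tr_superposing HTr).
  cart.
Qed.

Lemma trace_param (X A B : C) (f : hom (L X × A) X) (k : hom A B) :
  Tr X A B ⟨f, k ∘ prr (L X) A⟩ = k.
Proof. rewrite trace_post, trace_prr, comp_idr; reflexivity. Qed.

(** Vanishing merges the two feedback wires into one over [X × X]. Both carry [f], so the output
    factors through [diag X], which slides round to the input. *)
Lemma trace_trace_diag (X A B : C) (f : hom (L X × (L X × A)) X)
    (h : hom (L X × (L X × A)) B) :
  Tr X A B (Tr X (L X × A) (X × B) ⟨f, ⟨f, h⟩⟩) =
  Tr X A B (⟨f, h⟩ ∘ assoc (L X) (L X) A ∘ (diag (L X) ⊗ idm A)).
Proof.
  rewrite (tr_vanishing2 HTr).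
  transitivity (Tr (X × X) A B ((diag X ⊗ idm B) ∘
    (⟨f, h⟩ ∘ assoc (L X) (L X) A ∘ (can L X X ⊗ idm A)))).
  - f_equal; cart.
  - rewrite (tr_sliding HTr); f_equal; cart.
Qed.

Lemma trace_prl (X A : C) (f : hom (L X × A) X) :
  Tr X A (L X) ⟨f, prl (L X) A⟩ = pt X ∘ Tr X A X ⟨f, f⟩.
Proof.
  rewrite <- (tr_yanking HTr X), <- (tr_left_tightening HTr).
  (* Here [f] reads the inner wire only, and the outer wire is merely output. Merging the wires
     gives [⟨f, prl⟩]; evaluating the inner trace gives the yanked form. *)
  transitivity (Tr X A (L X) (Tr X (L X × A) (X × L X)
    ⟨f ∘ (idm (L X) ⊗ prr (L X) A), ⟨f ∘ (idm (L X) ⊗ prr (L X) A),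
      prl (L X) A ∘ prr (L X) (L X × A)⟩⟩)).
  - rewrite trace_trace_diag; f_equal; cart.
  - rewrite trace_pair, trace_pre, trace_param; f_equal; cart.
Qed.

Lemma trace_formula (X A B : C) (f : hom (L X × A) X)
    (h : hom (L X × A) B) :
  Tr X A B ⟨f, h⟩ = h ∘ ⟨pt X ∘ Tr X A X ⟨f, f⟩, idm A⟩.
Proof.
  rewrite <- (comp_idr h) at 1.
  rewrite trace_post, <- pair_prl_prr, trace_pair, trace_prl, trace_prr.
  reflexivity.
Qed.

Lemma conway_of_traced : guarded_conway p (dagger_of_trace Tr).
Proof.
  constructor; unfold dagger_of_trace.
  - intros X Y f; rewrite trace_formula at 1; cart.
  - intros X Y Z f h; rewrite <- trace_pre; reflexivity.
  (* One copy of [g] leaves through the output; the copy on the feedback wire slides. *)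
  - intros X Y Z f g; rewrite trace_post; f_equal.
    rewrite <- pair_comp, <- (tr_sliding HTr); f_equal; cart.
  - intros X Y f.
    rewrite <- trace_pair, trace_trace_diag; f_equal; cart.
Qed.

Lemma trace_of_dagger_of_trace (X A B : C) (f : hom (L X × A) (X × B)) :
  trace_of_dagger p (dagger_of_trace Tr) f = Tr X A B f.
Proof.
  unfold trace_of_dagger, dagger_of_trace.
  transitivity (Tr X A B ⟨prl X B ∘ f, prr X B ∘ f⟩).
  - rewrite (trace_formula _ (prr X B ∘ f)); cart.
  - rewrite pair_eta; reflexivity.
Qed.

End TraceToDagger.

(** * From guarded daggers to guarded traces *)

Section DaggerToTrace.
Context {C : cartesian_category} {L : functor C C}.
Context {p : nat_trans (id_functor C) L}.
Local Notation pt X := (p X : hom X (L X)).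
Context {dag : dagger_op L}.
Arguments dag : clear implicits.
Hypothesis Hdag : guarded_conway p dag.

Lemma dagger_unfold (X Y : C) (f : hom (L X × Y) X) :
  dag X Y f = f ∘ ⟨pt X ∘ dag X Y f, idm Y⟩.
Proof. rewrite (dag_fixpoint Hdag) at 1; cart. Qed.

(** A dagger over [Z] that sees its feedback only through [g] reduces to one over [X]: unfold once,
    then move [g] past [p] by naturality. *)
Lemma dagger_factor (X Z Y : C) (g : hom Z X) (f : hom (L X × Y) Z) :
  dag Z Y (f ∘ (fmap L g ⊗ idm Y)) =
  f ∘ ⟨pt X ∘ dag X Y (g ∘ f), idm Y⟩.
Proof.
  rewrite dagger_unfold, (dag_composition Hdag f g).
  cart_norm; rewrite point_natural_comp; reflexivity.
Qed.

Lemma dagger_bekic (X Y A : C) (t : hom (L X × (L Y × A)) X)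
    (s : hom (L X × (L Y × A)) Y) :
  let t' := dag X (L Y × A) t in
  let y := dag Y A (s ∘ ⟨pt X ∘ t', idm (L Y × A)⟩) in
  dag (X × Y) A (⟨t, s⟩ ∘ assoc (L X) (L Y) A ∘ (can L X Y ⊗ idm A)) =
  ⟨t' ∘ ⟨pt Y ∘ y, idm A⟩, y⟩.
Proof.
  intros t' y.
  (* The feedback wire is duplicated: the inner copy is read only through [prl], the outer only
     through [prr], so [dagger_factor] applies to each. *)
  transitivity (dag (X × Y) A (dag (X × Y) (L (X × Y) × A)
    (⟨t, s⟩ ∘ (idm (L X) ⊗ (fmap L (prr X Y) ⊗ idm A))
      ∘ (fmap L (prl X Y) ⊗ idm (L (X × Y) × A))))).
  { rewrite (dag_double Hdag); f_equal; cart. }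
  rewrite dagger_factor.
  transitivity (dag (X × Y) A
    (⟨t', s ∘ ⟨pt X ∘ t', idm (L Y × A)⟩⟩ ∘ (fmap L (prr X Y) ⊗ idm A))).
  - f_equal.
    rewrite (comp_assoc (prl X Y)), prl_pair, <- (dag_parameter Hdag).
    (* Only the first component of the target pair is unfolded. *)
    fold t'; rewrite (dagger_unfold t : t' = _) at 2; fold t'; cart.
  - rewrite dagger_factor, prr_pair; fold y.
    rewrite (dagger_unfold _ : y = _) at 3; fold y; cart.
Qed.

Lemma traced_of_conway : guarded_traced p (trace_of_dagger p dag).
Proof.
  constructor; unfold trace_of_dagger.
  - intros A B f; cart_norm; do 3 f_equal; apply bang_eq.
  - intros X Y A B f.
    pose (t := prl X (Y × B) ∘ f).
    pose (s := prl Y B ∘ (prr X (Y × B) ∘ f)).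
    transitivity (prr Y B ∘ (prr X (Y × B) ∘ f) ∘
      assoc (L X) (L Y) A ∘ (can L X Y ⊗ idm A) ∘
      ⟨pt (X × Y) ∘ dag (X × Y) A
        (⟨t, s⟩ ∘ assoc (L X) (L Y) A ∘ (can L X Y ⊗ idm A)), idm A⟩).
    (* Naturality of [p] brings the projections in [can] onto the dagger over [X × Y], whose
       components the Bekić identity supplies. *)
    + cart_norm; rewrite <- !point_natural_comp.
      pose proof (dagger_bekic t s) as E; revert E; unfold t, s; cart_norm.
      intros ->; cart.
    + unfold t, s; cart.
  - intros X A B D f.
    replace (prl X (B × D) ∘ (assoc X B D ∘ (f ⊗ idm D) ∘ assoc_inv (L X) A D))
      with ((prl X B ∘ f) ∘ (idm (L X) ⊗ prl A D)) by cart.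
    rewrite <- (dag_parameter Hdag); cart.
  - intros X.
    rewrite dagger_unfold; cart.
  - intros X A A' B f g.
    rewrite (comp_assoc (prl X B)), <- (dag_parameter Hdag); cart.
  - intros X A B B' f g; cart.
  - intros X X' A B f g.
    replace (prl X B ∘ (g ⊗ idm B ∘ f)) with (g ∘ (prl X' B ∘ f)) by cart.
    rewrite (dag_composition Hdag).
    cart_norm; rewrite point_natural_comp; reflexivity.
Qed.

Lemma dagger_of_trace_of_dagger (X Y : C) (f : hom (L X × Y) X) :
  dagger_of_trace (trace_of_dagger p dag) f = dag X Y f.
Proof.
  unfold dagger_of_trace, trace_of_dagger.
  rewrite prl_pair, prr_pair; symmetry; apply (dag_fixpoint Hdag).
Qed.

End DaggerToTrace.

Theorem theorem4p5 (C : cartesian_category) (L : functor C C)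
    (p : nat_trans (id_functor C) L) :
  (forall Tr : trace_op L, guarded_traced p Tr ->
     guarded_conway p (dagger_of_trace Tr) /\
     (forall (X A B : C) (f : hom (L X × A) (X × B)),
        trace_of_dagger p (dagger_of_trace Tr) f = Tr X A B f))
  /\
  (forall dag : dagger_op L, guarded_conway p dag ->
     guarded_traced p (trace_of_dagger p dag) /\
     (forall (X Y : C) (f : hom (L X × Y) X),
        dagger_of_trace (trace_of_dagger p dag) f = dag X Y f)).
Proof.
  split; intros op Hop; split.
  - exact (conway_of_traced Hop).
  - exact (trace_of_dagger_of_trace Hop).
  - exact (traced_of_conway Hop).
  - exact (dagger_of_trace_of_dagger Hop).
Qed.
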